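(* Let $n\ge1$. For the symmetric group $S_{2n}$, the element $(x_2)^{-1}$ is the probability distribution of the permutation produced by the following shuffle of a deck of $2n$ cards. Step 1: Choose an even number $2j$ with $0\le 2j\le 2n$, with the probability of getting $2j$ equal to $\binom{2n}{2j}/2^{2n-1}$. From the stack of $2n$ cards, form a second pile of size $2j$ by removing the top $j$ cards of the stack, and then putting the bottom $j$ cards of the first stack on top of them. Step 2: Now one has a stack of size $2n-2j$ and a stack of size $2j$. Drop cards repeatedly according to the rule that if stacks $1,2$ have sizes $A,B$ at some time, then the next card comes from stack $1$ with probability $\frac{A}{A+B}$ and from stack $2$ with probability $\frac{B}{A+B}$. (Equivalently, choose uniformly at random one of the $\binom{2n}{2j}$ interleavings preserving the relative orders of the cards in each stack.) For the symmetric group $S_{2n+1}$, the description of $(x_2)^{-1}$ is the same (with a deck of $2n+1$ cards), except that in Step 1 the chance of getting $2j$ (with $0\le 2j\le 2n$) is $\binom{2n+1}{2j}/2^{2n}$, and at the beginning of Step 2 one has a stack of size $2n+1-2j$ and a stack of size $2j$.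
   Context: For a positive integer $k$, the element $x_k$ (Cellini's element in type $A_{N-1}$) of the rational group algebra of $S_N$ is defined by: the coefficient of $w$ in $x_k$ is $\frac{1}{k^{N-1}}$ times the number of integer vectors $(v_1,\dots,v_N)$ such that (i) $v_1+\dots+v_N=0$; (ii) $v_1\ge v_2\ge\dots\ge v_N$ and $v_1-v_N\le k$; (iii) $v_i>v_{i+1}$ whenever $1\le i\le N-1$ and $w(i)>w(i+1)$; (iv) $v_1<v_N+k$ if $w(N)>w(1)$. If $x_k=\sum_w c_w w$, then $(x_k)^{-1}$ denotes $\sum_w c_w w^{-1}$. Convention: the deck initially has card $i$ in position $i$ from the top; the permutation $w$ produced by a shuffle is the one for which, after the shuffle, card $w(i)$ is in position $i$ from the top. Saying that $(x_2)^{-1}$ is the distribution means that for each $w$ the coefficient of $w$ in $(x_2)^{-1}$ is the probability that the shuffle produces $w$. *)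

(* Defs.v *)
From mathcomp Require Import all_boot all_order all_algebra all_fingroup.
From mathcomp Require Import finmap boolp classical_sets functions cardinality.
From mathcomp Require Import zify.

Set Implicit Arguments.
Unset Strict Implicit.
Unset Printing Implicit Defensive.

Import Order.TTheory GRing.Theory Num.Theory.
Local Open Scope ring_scope.

(* Positions and card labels 1, ..., N are represented by 0, ..., N - 1 in
   'I_N.  The vector space underlying the rational group algebra of S_N is
   {ffun 'S_N -> rat^o}: x w is the coefficient of w in x.  (rat^o is rat as a
   module over itself.)  The product is not needed. *)

Definition gbasis (N : nat) (w : 'S_N) : {ffun 'S_N -> rat^o} :=
  [ffun u => (u == w)%:R].

Definition ginv (N : nat) (x : {ffun 'S_N -> rat^o}) : {ffun 'S_N -> rat^o} :=
  \sum_(w : 'S_N) x w *: gbasis w^-1%g.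

(* Pairs (i, i1) with i1 = i + 1 are consecutive positions; pairs (i0, il) with
   i0 = 0 and il = N - 1 are the first and the last position. *)
Definition cellini_vector (N k : nat) (w : 'S_N) (v : {ffun 'I_N -> int}) :
    Prop :=
  [/\ \sum_(i < N) v i = 0,
      (forall i i1 : 'I_N, i1 = i.+1 :> nat -> v i1 <= v i) /\
      (forall i0 il : 'I_N, i0 = 0%N :> nat -> il = N.-1 :> nat ->
         v i0 - v il <= k%:Z),
      forall i i1 : 'I_N, i1 = i.+1 :> nat -> (w i1 < w i)%N -> v i1 < v i
    & forall i0 il : 'I_N, i0 = 0%N :> nat -> il = N.-1 :> nat ->
        (w i0 < w il)%N -> v i0 < v il + k%:Z].

(* fset_set A is the empty set when A is infinite, so that the cardinal below
   is the intended one because of this lemma. *)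
Lemma cellini_vector_finite (N k : nat) (w : 'S_N) :
  finite_set [set v | cellini_vector k w v]%classic.
Proof.
pose f (g : {ffun 'I_N -> 'I_(k + k).+1}) : {ffun 'I_N -> int} :=
  [ffun i => (g i)%:Z - k%:Z].
apply: (@sub_finite_set _ _ [set f g | g in setT]%classic); last first.
  exact/finite_image/finite_finset.
move=> v /= [sum0 [dec width] _ _].
have decE (m : nat) (i i' : 'I_N) : i' = (i + m)%N :> nat -> v i' <= v i.
  elim: m i' => [|m IH] i' e.
    by rewrite (_ : i' = i) //; apply/val_inj; rewrite /= e addn0.
  have lt : (i + m < N)%N by apply: leq_ltn_trans (ltn_ord i'); lia.
  by apply: le_trans (IH (Ordinal lt) erefl); apply: dec; rewrite /= e addnS.
have bnd i : - k%:Z <= v i <= k%:Z.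
  have N0 : (0 < N)%N by apply: leq_ltn_trans (ltn_ord i).
  have lN : (N.-1 < N)%N by rewrite prednK.
  set i0 := Ordinal N0; set il := Ordinal lN.
  have top j : v j <= v i0 by apply: (decE j).
  have bot j : v il <= v j.
    by apply: (decE (N.-1 - j)%N); have := ltn_ord j; rewrite /=; lia.
  have w0 := width i0 il erefl erefl.
  have top_ge0 : 0 <= v i0.
    rewrite leNgt; apply/negP => neg; have := sum0.
    apply/eqP; rewrite lt_eqF // (bigD1 i) //=.
    rewrite ltr_nwDl //; first exact: le_lt_trans neg.
    by apply: sumr_le0 => j _; apply: le_trans (top j) (ltW neg).
  have bot_le0 : v il <= 0.
    rewrite leNgt; apply/negP => pos; have := sum0.
    apply/eqP; rewrite gt_eqF // (bigD1 i) //=.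
    rewrite ltr_pwDl //; first exact: lt_le_trans (bot i).
    by apply: sumr_ge0 => j _; apply: le_trans (ltW pos) (bot j).
  by have := top i; have := bot i; lia.
exists [ffun i => inord (absz (v i + k%:Z))] => //.
apply/ffunP => i; rewrite !ffunE; have := bnd i; move: (v i) => z bz.
rewrite inordK; last by lia.
by rewrite gez0_abs; lia.
Qed.

Definition cellini (N k : nat) : {ffun 'S_N -> rat^o} :=
  [ffun w => #|` fset_set [set v | cellini_vector k w v]%classic|%:R
             / k%:R ^+ N.-1].

(* Decks and stacks of cards are sequences listed from the top card down. *)

(* Card w i is in position i. *)
Definition deck (N : nat) (w : 'S_N) : seq 'I_N := [seq w i | i <- enum 'I_N].

(* What is left of the stack s after moving its top j and bottom j cards. *)
Definition cut_rest (T : Type) (j : nat) (s : seq T) : seq T :=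
  take (size s - 2 * j) (drop j s).

(* The moved cards, for 2 * j <= size s: the bottom j above the top j. *)
Definition cut_pile (T : Type) (j : nat) (s : seq T) : seq T :=
  drop (size s - j) s ++ take j s.

(* Probability that the final pile is d, when m more cards are to be dropped
   from the stacks s1 and s2 (m = size s1 + size s2) onto the pile p of the
   cards dropped so far.  A card drops from the bottom of its stack and lands
   on top of the pile.  A term for an empty stack has weight 0. *)
Fixpoint drop_from (T : eqType) (m : nat) (s1 s2 p d : seq T) : rat :=
  if m is m'.+1 then
    let A := size s1 in
    let B := size s2 in
    A%:R / (A + B)%:R * drop_from m' (take A.-1 s1) s2 (drop A.-1 s1 ++ p) d
    + B%:R / (A + B)%:R * drop_from m' s1 (take B.-1 s2) (drop B.-1 s2 ++ p) d
  else (p == d)%:R.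

Definition drop_prob (T : eqType) (s1 s2 d : seq T) : rat :=
  drop_from (size s1 + size s2) s1 s2 [::] d.

(* For stacks of pairwise distinct cards. *)
Definition interleaving (T : eqType) (s1 s2 d : seq T) : bool :=
  [&& perm_eq d (s1 ++ s2), subseq s1 d & subseq s2 d].

Definition interleave_prob (T : eqType) (s1 s2 d : seq T) : rat :=
  (interleaving s1 s2 d)%:R / 'C(size s1 + size s2, size s2)%:R.

(* Probability that the shuffle of an N-card deck produces w, when j is chosen
   in {0, ..., n} with probability p j and the two stacks are then merged
   according to the law merge. *)
Definition shuffle_prob (N n : nat) (p : nat -> rat)
    (merge : seq 'I_N -> seq 'I_N -> seq 'I_N -> rat) (w : 'S_N) : rat :=
  \sum_(j < n.+1)
     p j * merge (cut_rest j (deck (1%g : 'S_N))) (cut_pile j (deck (1%g : 'S_N)))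
                 (deck w).

(* Main.v *)
Require Import Defs.
From mathcomp Require Import all_boot all_order all_algebra all_fingroup.
From mathcomp Require Import finmap classical_sets cardinality.
From mathcomp Require Import zify.

(** A decreasing integer vector of length N with sum 0 and width at most 2 is
    (1^j, 0^(N - 2j), (-1)^j) for a unique j with 2j <= N ([width2_stepE],
    [step_vector_inj]).  For this vector, Cellini's conditions on a permutation
    say that it increases along the two stacks obtained by moving the top j and
    bottom j cards of the ordered deck, the bottom ones above the top ones
    ([cellini_stepP]): between equal entries descents are forbidden, and the
    cyclic condition acts at the junction of the pile.  So the coefficient of
    x_2 at w^-1 is 1 / 2^(N - 1) times the number of cuts j for which w^-1
    increases along both stacks.
    As w^-1 gives the positions of the cards after the shuffle, these are the
    cuts whose stacks both keep their order in the deck w, that is, the cuts of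
    which this deck is an interleaving ([interleaving_deck]).  Such a cut is
    chosen with probability 'C(N, 2j) / 2^(N - 1) and then produces w with
    probability 1 / 'C(N, 2j), hence contributes 1 / 2^(N - 1), which is the
    weight of one vector in x_2 ([cellini2_shuffle]).

    Dropping cards with probabilities proportional to the stack sizes gives the
    uniform interleaving ([drop_probE]): the first card dropped, which ends at
    the bottom, comes from the stack of size A with probability A / (A + B), and
    A 'C(A + B, B) = (A + B) 'C(A + B - 1, B). *)

Set Implicit Arguments.
Unset Strict Implicit.
Unset Printing Implicit Defensive.

Import Order.TTheory GRing.Theory Num.Theory.
Local Open Scope ring_scope.

(** * Interleavings and card drops *)

Lemma subseq_rcons (T : eqType) (x y : T) (s t : seq T) :
  subseq (rcons s x) (rcons t y) =
  if x == y then subseq s t else subseq (rcons s x) t.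
Proof.
rewrite -subseq_rev !rev_rcons -(subseq_rev s) -(subseq_rev _ t) rev_rcons /=.
by case: eqP.
Qed.

Lemma interleavingC (T : eqType) (s1 s2 d : seq T) :
  interleaving s1 s2 d = interleaving s2 s1 d.
Proof.
rewrite /interleaving (perm_sym d) (permPl (permEl (perm_catC s1 s2))).
by rewrite (perm_sym _ d) [subseq _ _ && _]andbC.
Qed.

(** Reading an interleaving from the bottom: if its last card comes from the
    first stack, it is the bottom card of that stack, since the stack keeps its
    order; what lies above interleaves the remaining cards. *)
Lemma interleaving_rcons (T : eqType) (x y : T) (s t d : seq T) :
  uniq (rcons s x ++ t) ->
  (y \in rcons s x) && interleaving (rcons s x) t (rcons d y) =
  (x == y) && interleaving s t d.
Proof.
move=> us; rewrite mem_rcons inE [y == x]eq_sym.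
have [<-|xy] := eqVneq x y; last first.
  rewrite /=; apply/and4P => -[ys p h _].
  have ud : uniq (rcons d y) by rewrite (perm_uniq p).
  move: h ud; rewrite subseq_rcons (negPf xy) rcons_uniq => h /andP [/negP []].
  by rewrite (mem_subseq h) // mem_rcons inE ys orbT.
rewrite /= /interleaving subseq_rcons eqxx; congr [&& _, _ & _].
  rewrite -cats1 -cat1s -[rcons s x]cats1 -catA.
  by rewrite perm_catC perm_sym perm_catCA perm_sym perm_cat2l.
have xt : x \notin t.
  move: us; rewrite cat_uniq => /and3P [_ /hasPn h _].
  by apply/negP => /h /=; rewrite mem_rcons mem_head.
case: (lastP t) xt => [|t' z] xt; first by rewrite !sub0seq.
rewrite subseq_rcons; case: eqP => // zx.
by move: xt; rewrite -zx mem_rcons mem_head.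
Qed.

Lemma interleave_probC (T : eqType) (s1 s2 d : seq T) :
  interleave_prob s1 s2 d = interleave_prob s2 s1 d.
Proof.
rewrite /interleave_prob interleavingC -bin_sub ?leq_addl // addnK.
by rewrite [(size s1 + _)%N]addnC.
Qed.

(** Dropped cards are never moved again, so the pile stays at the bottom. *)
Lemma drop_from_suffix (T : eqType) (m : nat) (s1 s2 p d : seq T) :
  ~~ suffix p d -> drop_from m s1 s2 p d = 0.
Proof.
elim: m s1 s2 p => [|m IH] s1 s2 p npd /=.
  by case: eqP npd => // ->; rewrite suffix_refl.
by rewrite !IH ?mulr0 ?addr0 //; apply: contra npd;
   apply: suffix_trans; apply: suffix_suffix.
Qed.

Lemma drop_from_mismatch (T : eqType) (m : nat) (x y : T) (s1 s2 p d : seq T) :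
  x != y -> drop_from m s1 s2 (x :: p) (rcons d y ++ p) = 0.
Proof.
move=> xy; apply: drop_from_suffix; apply/negP; rewrite suffixE.
rewrite size_cat size_rcons /= -cats1.
have -> : ((size d).+1 + size p - (size p).+1 = size d)%N by lia.
by rewrite -catA drop_size_cat // => /eqP [yx]; rewrite yx eqxx in xy.
Qed.

(** One of the two terms of a drop, for the stack [s] against the other stack
    [t]: since m 'C(m - 1, b) = (m - b) 'C(m, b), the weight of a drop turns the
    uniform law on the interleavings of the remaining m - 1 cards into the
    uniform law on those interleavings of all m cards that end in a card of
    [s].  The continuation [G] of the drop is abstract so that the lemma serves
    both stacks; its arguments are the rest of [s] and the dropped card. *)
Lemma drop_step (T : eqType) (s t d : seq T) (y : T)
    (G : seq T -> seq T -> rat) :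
  uniq (s ++ t) ->
  (forall s' x, s = rcons s' x ->
     G s' [:: x] = (x == y)%:R * interleave_prob s' t d) ->
  (size s)%:R / (size s + size t)%:R
    * G (take (size s).-1 s) (drop (size s).-1 s) =
  ((y \in s) && interleaving s t (rcons d y))%:R
    / 'C(size s + size t, size t)%:R.
Proof.
case/lastP: s => [|s x] us GE; first by rewrite /= !mul0r.
rewrite interleaving_rcons // size_rcons /= -cats1 take_size_cat //.
rewrite drop_size_cat // (GE s x) ?cats1 //.
case: eqP => [_|_]; last by rewrite /= mul0r mulr0 mul0r.
rewrite mul1r /= /interleave_prob.
have := mul_bin_down (size s + size t).+1 (size t).
rewrite addSn /= -addSn addnK => /(congr1 (fun k => k%:R : rat)).
rewrite !natrM => e.
rewrite mulrCA; congr (_ * _).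
by rewrite -mulrA -invfM e invfM mulrA divff ?mul1r // pnatr_eq0.
Qed.

(** The pile [p] is carried along because the induction drops cards onto it; a
    target that does not end in [p] is unreachable. *)
Lemma drop_fromE (T : eqType) (m : nat) (s1 s2 p d : seq T) :
  uniq (s1 ++ s2) -> m = (size s1 + size s2)%N -> size d = m ->
  drop_from m s1 s2 p (d ++ p) = interleave_prob s1 s2 d.
Proof.
elim: m s1 s2 p d => [|m IH] s1 s2 p d us ms dm.
  case: s1 us ms => //; case: s2 => // _ _; case: d dm => // _.
  by rewrite /= eqxx.
case/lastP: d dm => // d y; rewrite size_rcons => -[dm].
have us' : uniq (s2 ++ s1) by rewrite uniq_catC.
rewrite /= (@drop_step _ s1 s2 d y (fun s q => drop_from m s s2 (q ++ p) _)) //;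
  last first.
  move=> s x sE; rewrite sE cat_rcons -cat1s uniq_catCA cat_uniq in us.
  rewrite sE size_rcons in ms.
  have [<-|xy] := eqVneq x y; last by rewrite drop_from_mismatch // mul0r.
  rewrite cat_rcons mul1r IH //; last by case: ms.
  by case/and3P: us.
rewrite addnC.
rewrite (@drop_step _ s2 s1 d y (fun s q => drop_from m s1 s (q ++ p) _)) //;
  last first.
  move=> s x sE; rewrite sE cat_rcons -cat1s uniq_catCA cat_uniq in us'.
  rewrite sE size_rcons addnS in ms.
  have [<-|xy] := eqVneq x y; last by rewrite drop_from_mismatch // mul0r.
  rewrite cat_rcons mul1r IH //; last by case: ms.
    by rewrite interleave_probC.
  by rewrite uniq_catC; case/and3P: us'.
rewrite [(size s2 + _)%N]addnC -[in X in _ + _ / X]bin_sub ?leq_addr //.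
rewrite addKn -mulrDl /interleave_prob (interleavingC s2 s1); congr (_ / _).
(* The bottom card of the target comes from exactly one of the two stacks. *)
case: (boolP (interleaving s1 s2 _)) => [I|_]; last by rewrite !andbF addr0.
rewrite !andbT.
have /and3P [/perm_mem /(_ y) h _ _] := I.
rewrite mem_rcons mem_head mem_cat in h.
have /and3P [_ /hasPn dis _] : [&& uniq s1, ~~ has (mem s1) s2 & uniq s2].
  by rewrite -cat_uniq.
case: (boolP (y \in s2)) h => [/dis /= /negPf -> _|_]; first by rewrite add0r.
by rewrite orbF => <-; rewrite addr0.
Qed.

Lemma drop_probE (T : eqType) (s1 s2 d : seq T) :
  uniq (s1 ++ s2) -> size d = (size s1 + size s2)%N ->
  drop_prob s1 s2 d = interleave_prob s1 s2 d.
Proof. by move=> us sd; rewrite -(drop_fromE [::] us erefl sd) cats0. Qed.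

(** * The deck and its cut *)

Lemma cut_perm (T : eqType) (j : nat) (s : seq T) :
  (j.*2 <= size s)%N -> perm_eq (cut_rest j s ++ cut_pile j s) s.
Proof.
move=> js; rewrite /cut_rest /cut_pile catA perm_catC.
rewrite -[X in perm_eq _ X](cat_take_drop j s) perm_cat2l.
rewrite -[X in perm_eq _ X](cat_take_drop (size s - 2 * j) (drop j s)) perm_cat2l.
by rewrite drop_drop (_ : size s - 2 * j + j = size s - j)%N //; lia.
Qed.

Lemma deck1 (N : nat) : deck (1%g : 'S_N) = enum 'I_N.
Proof. by rewrite /deck -[RHS]map_id; apply: eq_map => i; rewrite perm1. Qed.

Lemma deck_perm (N : nat) (w : 'S_N) : perm_eq (deck w) (enum 'I_N).
Proof.
apply: uniq_perm; rewrite ?enum_uniq //.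
  by rewrite map_inj_uniq ?enum_uniq //; apply: perm_inj.
move=> x; rewrite mem_enum; apply/mapP; exists (w^-1 x)%g; rewrite ?mem_enum //.
by rewrite permKV.
Qed.

(** [w^-1 a] is the position of card [a], so a stack keeps its order in the
    shuffled deck exactly when positions increase along it. *)
Lemma subseq_deck (N : nat) (w : 'S_N) (s : seq 'I_N) :
  subseq s (deck w) = sorted (fun a b : 'I_N => (w^-1 a < w^-1 b)%g%N) s.
Proof.
set r := fun a b : 'I_N => _.
have rt : transitive r by move=> a b c; apply: ltn_trans.
have ri : irreflexive r by move=> a; apply: ltnn.
have sd : sorted r (deck w).
  rewrite sorted_map (@eq_sorted _ _ (relpre val ltn)); last first.
    by move=> a b; rewrite /r /= !permK.
  by rewrite -sorted_map val_enum_ord iota_ltn_sorted.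
apply/idP/idP => [h|ss]; first exact: (subseq_sorted rt h).
have -> : s = filter (mem s) (deck w).
  apply: (irr_sorted_eq rt ri) => //; first exact: sorted_filter.
  by move=> x; rewrite mem_filter (perm_mem (deck_perm w)) mem_enum andbT.
exact: filter_subseq.
Qed.

Definition increasing_on_cut (N : nat) (u : 'S_N) (j : nat) : bool :=
  sorted (fun a b : 'I_N => (u a < u b)%N) (cut_rest j (enum 'I_N)) &&
  sorted (fun a b : 'I_N => (u a < u b)%N) (cut_pile j (enum 'I_N)).

Lemma interleaving_deck (N j : nat) (w : 'S_N) : (j.*2 <= N)%N ->
  interleaving (cut_rest j (enum 'I_N)) (cut_pile j (enum 'I_N)) (deck w) =
  increasing_on_cut w^-1%g j.
Proof.
move=> jN; rewrite /interleaving !subseq_deck.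
rewrite (permPl (deck_perm w)) perm_sym cut_perm //.
by rewrite size_enum_ord.
Qed.

(** * Vectors of width at most 2 and sum 0 *)

Lemma down_closed_threshold (N : nat) (P : pred 'I_N) :
  (forall i i' : 'I_N, (i' <= i)%N -> P i -> P i') ->
  exists2 a, (a <= N)%N & forall i, P i = (i < a)%N.
Proof.
move=> dP; exists (find (predC P) (enum 'I_N)).
  by rewrite -[leqRHS]size_enum_ord find_size.
move=> i; apply/idP/idP => [Pi|lt].
  rewrite ltnNge; apply/negP => le.
  have has_nP : has (predC P) (enum 'I_N).
    by rewrite has_find size_enum_ord (leq_ltn_trans le).
  have /= := nth_find i has_nP; apply/negP; rewrite negbK.
  apply: dP Pi; rewrite nth_enum_ord //.
  by rewrite -[ltnRHS]size_enum_ord -has_find.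
by have /= := before_find i lt; rewrite nth_ord_enum => /negPn.
Qed.

(** The vector (1^j, 0^(N - 2j), (-1)^j), for 2j <= N.  As a sum of two
    thresholds, it makes its sum and the inequalities between its entries
    immediate. *)
Definition step_vector (N j : nat) : {ffun 'I_N -> int} :=
  [ffun i : 'I_N => (i < j)%N%:Z + (i < N - j)%N%:Z - 1].

Lemma sum_lt_ord (N a : nat) : (a <= N)%N ->
  \sum_(i < N) ((i < a)%N%:Z) = a%:Z.
Proof.
move=> aN; have -> : a%:Z = \sum_(i < a) 1 by rewrite sumr_const card_ord natz.
rewrite (big_ord_widen N (fun=> 1)) // [RHS]big_mkcond.
by apply: eq_bigr => i _; case: ifP.
Qed.

Lemma sum_thresholds (N a b : nat) : (a <= N)%N -> (b <= N)%N ->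
  \sum_(i < N) ((i < a)%N%:Z + (i < b)%N%:Z - 1) = (a + b)%:Z - N%:Z.
Proof.
move=> aN bN; rewrite sumrB big_split /= !sum_lt_ord // sumr_const card_ord.
by rewrite natz PoszD.
Qed.

(** A sum 0 forces entries of both signs unless all vanish, so width at most 2
    confines the entries to -1, 0, 1.  A decreasing vector with these entries is
    given by two thresholds a <= b, and its sum a + b - N vanishes only when
    b = N - a. *)
Lemma width2_stepE (N : nat) (v : {ffun 'I_N -> int}) :
  \sum_(i < N) v i = 0 ->
  (forall i i1 : 'I_N, i1 = i.+1 :> nat -> v i1 <= v i) ->
  (forall i0 il : 'I_N, i0 = 0%N :> nat -> il = N.-1 :> nat ->
     v i0 - v il <= 2) ->
  exists2 j, (j.*2 <= N)%N & v = step_vector N j.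
Proof.
move=> sum0 dec width.
have anti (i i' : 'I_N) : (i <= i')%N -> v i' <= v i.
  move=> /subnKC; move: (i' - i)%N => m; elim: m i' => [|m IH] i' e.
    by rewrite (_ : i' = i) //; apply/val_inj; rewrite /= -e addn0.
  have lt : (i + m < N)%N by apply: leq_ltn_trans (ltn_ord i'); lia.
  by apply: le_trans (IH (Ordinal lt) erefl); apply: dec; rewrite /= -e addnS.
have width' (i i' : 'I_N) : v i - v i' <= 2.
  have N0 : (0 < N)%N by apply: leq_ltn_trans (ltn_ord i).
  have lN : (N.-1 < N)%N by rewrite prednK.
  have := width (Ordinal N0) (Ordinal lN) erefl erefl.
  have := anti (Ordinal N0) i; have := anti i' (Ordinal lN).
  by have := ltn_ord i'; rewrite /=; lia.
have bnd i : -1 <= v i <= 1.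
  apply/andP; split; rewrite leNgt; apply/negP => out; have := sum0; apply/eqP.
    rewrite lt_eqF // (bigD1 i) //= ltr_nwDl //; first by lia.
    by apply: sumr_le0 => i' _; have := width' i' i; lia.
  rewrite gt_eqF // (bigD1 i) //= ltr_pwDl //; first by lia.
  by apply: sumr_ge0 => i' _; have := width' i i'; lia.
have [|a aN Ha] := @down_closed_threshold N (fun i => v i == 1).
  by move=> i i' /anti; have := bnd i'; lia.
have [|b bN Hb] := @down_closed_threshold N (fun i => v i != -1).
  by move=> i i' /anti; have := bnd i; lia.
have vE i : v i = (i < a)%N%:Z + (i < b)%N%:Z - 1.
  by have := bnd i; rewrite -Ha -Hb; case: eqP => [->|]; case: eqP => //=; lia.
have ab : (a <= b)%N.
  rewrite leqNgt; apply/negP => lt; pose i := Ordinal (leq_trans lt aN).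
  have := Ha i; have := Hb i; rewrite /= ltnn lt => /negbFE /eqP ->.
  by [].
have abN : (a + b = N)%N.
  move: sum0; rewrite (eq_bigr _ (fun i _ => vE i)) sum_thresholds //; lia.
exists a; first by lia.
by apply/ffunP => i; rewrite ffunE vE; congr (_ + _%:Z - _); lia.
Qed.

Lemma step_vector_inj (N j j' : nat) : (j.*2 <= N)%N -> (j'.*2 <= N)%N ->
  step_vector N j = step_vector N j' -> j = j'.
Proof.
wlog lt : j j' / (j < j')%N.
  move=> W jN j'N e; case: (ltngtP j j') => // lt; first exact: W e.
  by apply/esym/W.
move=> jN j'N /ffunP e.
(* Entry j is 1 in one vector and smaller in the other. *)
have jlt : (j < N)%N by lia.
by have := e (Ordinal jlt); rewrite !ffunE /=; lia.
Qed.

(** * Cellini's conditions on a cut *)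

Lemma sorted_cut_rest (N j : nat) (r : rel 'I_N) : (0 < N)%N -> (j.*2 <= N)%N ->
  reflect (forall i i1 : 'I_N, i1 = i.+1 :> nat ->
             (j <= i)%N -> (i1 < N - j)%N -> r i i1)
          (sorted r (cut_rest j (enum 'I_N))).
Proof.
move=> N0 jN; pose o := Ordinal N0; set s := cut_rest _ _.
have sz : size s = (N - j.*2)%N.
  by rewrite size_take size_drop size_enum_ord; case: ifP; lia.
have nthE k : (k < N - j.*2)%N -> nth o s k = (j + k)%N :> nat.
  move=> lt; rewrite nth_take ?size_enum_ord; last by lia.
  by rewrite nth_drop nth_enum_ord //; lia.
apply: (iffP (sortedP o)) => S; rewrite sz in S *.
  move=> i i1 e ji lt; have Sij := S (i - j)%N.
  have ei : nth o s (i - j) = i by apply/ord_inj; rewrite nthE; lia.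
  have ei1 : nth o s (i - j).+1 = i1 by apply/ord_inj; rewrite nthE; lia.
  by rewrite ei ei1 in Sij; apply: Sij; lia.
by move=> k lt; apply: S; rewrite !nthE; lia.
Qed.

(** The second conjunct is the junction inside the pile: the old bottom card
    [il] of the deck now lies directly above the old top card [i0]. *)
Lemma sorted_cut_pile (N j : nat) (r : rel 'I_N) : (0 < N)%N -> (j.*2 <= N)%N ->
  reflect ((forall i i1 : 'I_N, i1 = i.+1 :> nat ->
              (i1 < j)%N || (N - j <= i)%N -> r i i1) /\
           (forall i0 il : 'I_N, i0 = 0%N :> nat -> il = N.-1 :> nat ->
              (0 < j)%N -> r il i0))
          (sorted r (cut_pile j (enum 'I_N))).
Proof.
move=> N0 jN; pose o := Ordinal N0; set s := cut_pile _ _.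
have szd : size (drop (N - j) (enum 'I_N)) = j.
  by rewrite size_drop size_enum_ord; lia.
have sz : size s = j.*2.
  rewrite size_cat size_enum_ord szd size_take size_enum_ord.
  by case: ifP; lia.
have nthE k : (k < j.*2)%N ->
    nth o s k = (if k < j then N - j + k else k - j)%N :> nat.
  move=> lt; rewrite nth_cat size_enum_ord szd; case: ifP => kj.
    by rewrite nth_drop nth_enum_ord //; lia.
  by rewrite nth_take ?nth_enum_ord //; lia.
apply: (iffP (sortedP o)) => [S|[S wrap]]; rewrite sz in S *; last first.
  move=> k lt; have [kj|kj] := eqVneq k.+1 j.
    have [lt1 lt0] : (k < j)%N /\ ~~ (k.+1 < j)%N by lia.
    by apply: wrap; rewrite ?nthE ?lt1 ?(negPf lt0); lia.
  apply: S; rewrite !nthE; try lia.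
    by case: ifP; case: ifP; lia.
  by case: ifP; case: ifP; lia.
have S_at k (i i1 : 'I_N) : (k.+1 < j.*2)%N ->
    (if k < j then N - j + k else k - j)%N = i ->
    (if k.+1 < j then N - j + k.+1 else k.+1 - j)%N = i1 -> r i i1.
  move=> lt ei ei1; have := S k lt; congr (r _ _); apply/ord_inj.
    by rewrite nthE ?ei //; lia.
  by rewrite nthE ?ei1.
split=> [i i1 e /orP [lt|le]|i0 il e0 el j0].
- by apply: (S_at (j + i)%N); [lia|case: ifP; lia|case: ifP; lia].
- have := ltn_ord i1 => i1N.
  by apply: (S_at (i - (N - j))%N); [lia|case: ifP; lia|case: ifP; lia].
by apply: (S_at j.-1); [lia|case: ifP; lia|case: ifP; lia].
Qed.

(** The vector is constant on each of the three blocks of positions of lengths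
    j, N - 2j, j, so the descents of [w] are confined to the boundaries between
    blocks: [w] increases on each block.  For j > 0 the first and last entries
    differ by exactly 2, so the cyclic condition forbids w(1) < w(N) and joins
    the last block to the first one, in the order in which the moved pile
    stacks them. *)
Lemma cellini_stepP (N j : nat) (w : 'S_N) : (0 < N)%N -> (j.*2 <= N)%N ->
  reflect (cellini_vector 2 w (step_vector N j)) (increasing_on_cut w j).
Proof.
move=> N0 jN.
have ltNgt (a b : 'I_N) : a <> b :> nat -> (w a < w b)%N = ~~ (w b < w a)%N.
  move=> ab; rewrite -leqNgt [RHS]leq_eqVlt.
  by case: eqP => // /ord_inj /perm_inj e; case: ab; rewrite e.
apply: (iffP andP).
  move=> [/(sorted_cut_rest _ N0 jN) R /(sorted_cut_pile _ N0 jN) [P wrap]].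
  split.
  - rewrite (eq_bigr (fun i : 'I_N => (i < j)%N%:Z + (i < N - j)%N%:Z - 1)).
      by rewrite sum_thresholds; lia.
    by move=> i _; rewrite ffunE.
  - by split=> [i i1 e|i0 il _ _]; rewrite !ffunE; lia.
  - move=> i i1 e desc; rewrite !ffunE.
    (* Entries drop only across a boundary between blocks. *)
    suff : (i.+1 == j) || (i.+1 == N - j)%N by lia.
    apply: contraLR desc; rewrite negb_or => /andP [ij iNj].
    rewrite -ltNgt; last by lia.
    case: (boolP ((i1 < j)%N || (N - j <= i)%N)) => [/(P i i1 e) //|].
    by rewrite negb_or => /andP [? ?]; apply: R => //; lia.
  - move=> i0 il e0 el asc; rewrite !ffunE.
    case: (posnP j) => [|/(wrap i0 il e0 el)]; lia.
case=> _ _ desc wrap; split.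
  apply/(sorted_cut_rest _ N0 jN) => i i1 e ji lt.
  rewrite ltNgt; last by lia.
  by apply/negP => /(desc i i1 e); rewrite !ffunE; lia.
apply/(sorted_cut_pile _ N0 jN); split=> [i i1 e ij|i0 il e0 el j0].
  rewrite ltNgt; last by lia.
  by apply/negP => /(desc i i1 e); rewrite !ffunE; lia.
rewrite ltNgt; last by lia.
by apply/negP => /(wrap i0 il e0 el); rewrite !ffunE; lia.
Qed.

(** * The shuffle *)

Lemma ginvE (N : nat) (x : {ffun 'S_N -> rat^o}) (w : 'S_N) :
  ginv x w = x w^-1%g.
Proof.
rewrite /ginv sum_ffunE (bigD1 w^-1%g) //= big1 => [|u uw].
  by rewrite !ffunE invgK eqxx addr0 /GRing.scale /= mulr1.
rewrite !ffunE; case: eqP => [e|_]; last by rewrite /GRing.scale /= mulr0.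
by rewrite e invgK eqxx in uw.
Qed.

Lemma cellini2E (N : nat) (w : 'S_N) : (0 < N)%N ->
  cellini N 2 w =
  (\sum_(j < N./2.+1) (increasing_on_cut w j)%:R) / 2 ^+ N.-1.
Proof.
move=> N0; rewrite ffunE; congr (_ / _).
have le (j : 'I_N./2.+1) : (j.*2 <= N)%N by have := ltn_ord j; lia.
rewrite -natr_sum; congr _%:R.
have -> : [set v | cellini_vector 2 w v]%classic =
    [set` [fset step_vector N (val j)
          | j in [pred j : 'I_N./2.+1 | increasing_on_cut w j]]%fset]%classic.
  apply/seteqP; split=> v /=.
    move=> cv; have [sum0 [dec width] _ _] := cv.
    have [j jN vE] := width2_stepE sum0 dec width.
    have jlt : (j < N./2.+1)%N by lia.
    apply/imfsetP; exists (Ordinal jlt) => //=.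
    by apply/cellini_stepP; rewrite -?vE.
  by move=> /imfsetP [j /= gj ->]; apply/cellini_stepP.
rewrite set_fsetK card_in_imfset /=; last first.
  by move=> j j' _ _ /step_vector_inj e; apply/val_inj/e.
by rewrite -cardE -sum1_card big_mkcond.
Qed.

Lemma shuffle_drop (N n : nat) (p : nat -> rat) (w : 'S_N) : (n.*2 <= N)%N ->
  shuffle_prob n p (@drop_prob _) w = shuffle_prob n p (@interleave_prob _) w.
Proof.
move=> nN; apply: eq_bigr => j _; congr (_ * _); rewrite deck1.
have jN : (j.*2 <= size (enum 'I_N))%N.
  by rewrite size_enum_ord; have := ltn_ord j; lia.
apply: drop_probE; first by rewrite (perm_uniq (cut_perm jN)) enum_uniq.
by rewrite -size_cat (perm_size (cut_perm jN)) (perm_size (deck_perm w)).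
Qed.

(** The binomial coefficient in the law of the cut cancels the number of
    interleavings, so every cut that can produce [w] contributes 1 / 2^(N - 1). *)
Lemma cellini2_shuffle (N : nat) (w : 'S_N) : (0 < N)%N ->
  ginv (cellini N 2) w =
  shuffle_prob N./2 (fun j => 'C(N, 2 * j)%:R / 2 ^+ N.-1)
    (@interleave_prob _) w.
Proof.
move=> N0; rewrite ginvE cellini2E // mulr_suml; apply: eq_bigr => j _.
have jN : (j.*2 <= N)%N by have := ltn_ord j; lia.
rewrite -interleaving_deck // deck1 /interleave_prob.
have szp : size (cut_pile j (enum 'I_N)) = (2 * j)%N.
  by rewrite size_cat size_drop size_take size_enum_ord; case: ifP; lia.
have -> : (size (cut_rest j (enum 'I_N)) + size (cut_pile j (enum 'I_N)) = N)%N.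
  by rewrite -size_cat (perm_size (cut_perm _)) size_enum_ord.
rewrite szp [RHS]mulrCA mulrAC divff ?mul1r //.
by rewrite pnatr_eq0 -lt0n bin_gt0; lia.
Qed.

Theorem proposition1 (n : nat) (n_ge1 : (1 <= n)%N) :
  (forall w : 'S_(2 * n),
     let p (j : nat) : rat := 'C(2 * n, 2 * j)%:R / 2 ^+ (2 * n - 1) in
     ginv (cellini (2 * n) 2) w = shuffle_prob n p (@drop_prob _) w /\
     ginv (cellini (2 * n) 2) w = shuffle_prob n p (@interleave_prob _) w) /\
  (forall w : 'S_(2 * n + 1),
     let p (j : nat) : rat := 'C(2 * n + 1, 2 * j)%:R / 2 ^+ (2 * n) in
     ginv (cellini (2 * n + 1) 2) w = shuffle_prob n p (@drop_prob _) w /\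
     ginv (cellini (2 * n + 1) 2) w = shuffle_prob n p (@interleave_prob _) w).
Proof.
split=> w p; rewrite shuffle_drop; try lia.
  suff : ginv (cellini (2 * n) 2) w = shuffle_prob n p (@interleave_prob _) w.
    by [].
  rewrite cellini2_shuffle; last by lia.
  by rewrite (_ : (2 * n)./2 = n) -?subn1 //; lia.
suff : ginv (cellini (2 * n + 1) 2) w
    = shuffle_prob n p (@interleave_prob _) w by [].
rewrite cellini2_shuffle; last by lia.
by rewrite (_ : (2 * n + 1)./2 = n) -?subn1 ?addnK //; lia.
Qed.
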